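(* For any irrational number $x\in(0,1)$ and any integer $n\ge1$, $$L_n(x,\mathcal{CF},\mathcal F)=2q_n(x)+q_{n-1}(x)-2.$$
   Context: $\mathbb N$ includes $0$. For an irrational $x\in(0,1)$ with continued fraction expansion $x=[0;a_1,a_2,\dots]$, set $p_{-1}=1,p_0=0,q_{-1}=0,q_0=1$, $p_n=a_np_{n-1}+p_{n-2}$, $q_n=q_n(x)=a_nq_{n-1}+q_{n-2}$. $\mathcal{CF}$ is the continued fraction sequence of partitions of $[0,1]$ into open intervals: its depth-$0$ partition is $\{(0,1)\}$, and its depth-$n$ interval containing the irrational $x$ ($n\ge1$) is the open interval $I_n^{\mathcal{CF}}(x)$ with endpoints $\frac{p_n}{q_n}$ and $\frac{p_n+p_{n-1}}{q_n+q_{n-1}}$. $\mathcal F=\{F_n\}_{n\in\mathbb N}$ is the Farey sequence of partitions: $F_n$ consists of the open intervals between consecutive elements of $\{p/q:0\le p\le q\le n+1,\ q\ge1,\ \gcd(p,q)=1\}$, and $I_n^{\mathcal F}(x)$ is the interval of $F_n$ containing $x$. The Lochs index is $L_n(x,\mathcal{CF},\mathcal F)=\sup\{\ell\in\mathbb N: I_n^{\mathcal{CF}}(x)\subseteq I_\ell^{\mathcal F}(x)\}$. *)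

(* Defs.v *)
From mathcomp Require Import all_boot all_order all_algebra.
From mathcomp Require Import all_classical all_reals ereal.

Set Implicit Arguments.
Unset Strict Implicit.
Unset Printing Implicit Defensive.

Import Order.TTheory GRing.Theory Num.Theory.
Local Open Scope classical_set_scope.
Local Open Scope ring_scope.

Section Defs.
Variable R : realType.
Implicit Types (x y : R) (n l : nat).

(* The open interval with endpoints u and v, given in either order. *)
Definition open_between (u v : R) : set R :=
  [set` `]Num.min u v, Num.max u v[].

Definition gauss_map x : R := x^-1 - (Num.truncn x^-1)%:R.

(* The partial quotient a_n of x = [0; a_1, a_2, ...], for n >= 1. *)
Definition cf_digit x n : nat := Num.truncn (iter n.-1 gauss_map x)^-1.

(* In both recursions the innermost constant is the value at index -1. *)
Fixpoint cf_num x n : nat :=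
  match n with
  | 0 => 0
  | m.+1 => cf_digit x n * cf_num x m + if m is k.+1 then cf_num x k else 1
  end%N.

Fixpoint cf_den x n : nat :=
  match n with
  | 0 => 1
  | m.+1 => cf_digit x n * cf_den x m + if m is k.+1 then cf_den x k else 0
  end%N.

(* Meaningful for n >= 1 only: at n = 0 the index n.-1 is 0, not -1. *)
Definition cf_interval x n : set R :=
  open_between
    ((cf_num x n)%:R / (cf_den x n)%:R)
    ((cf_num x n + cf_num x n.-1)%:R / (cf_den x n + cf_den x n.-1)%:R).

(* A sequence of partitions of [0, 1] is the family of its sets of open
   intervals, indexed by depth. *)
Definition CF n : set (set R) :=
  if n is 0 then [set [set` `]0, 1[]]
  else [set I | exists y, [/\ irrational y, 0 < y < 1 & I = cf_interval y n]].

Definition farey_points n : set R :=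
  [set r | exists p q : nat,
     [/\ (p <= q <= n.+1)%N, (1 <= q)%N, coprime p q & r = p%:R / q%:R]].

Definition Farey n : set (set R) :=
  [set I | exists a b : R,
     [/\ farey_points n a, farey_points n b, a < b,
         forall c, farey_points n c -> ~~ (a < c < b)
       & I = [set` `]a, b[]]].

(* The member of the depth-n partition that contains x; the default set0 is
   only reached when no member contains x. *)
Definition cell (P : nat -> set (set R)) n x : set R :=
  xget set0 [set I | P n I /\ I x].

(* The supremum is taken in the extended reals, where it always exists. *)
Definition lochs_index n x (P Q : nat -> set (set R)) : \bar R :=
  ereal_sup [set (l%:R : R)%:E | l in [set l | cell P n x `<=` cell Q l x]].

End Defs.

Arguments CF {R} n.
Arguments Farey {R} n.

(* Main.v *)
Require Import Defs.
From mathcomp Require Import all_boot all_order all_algebra.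
From mathcomp Require Import all_classical all_reals ereal.
From mathcomp Require Import zify ring lra.

Import Order.TTheory GRing.Theory Num.Theory.
Local Open Scope classical_set_scope.
Local Open Scope ring_scope.

(* The endpoints p_n/q_n and (p_n+p_{n-1})/(q_n+q_{n-1}) of the depth-n cell have
   determinant +-1, so every fraction strictly between them has denominator at
   least q_n + (q_n+q_{n-1}), with equality for the mediant. The cell therefore
   lies in a single interval of F_l exactly when l + 1 < 2q_n + q_{n-1}. *)

(** * Open intervals with unordered endpoints *)

Section OpenBetween.
Variable R : realType.
Implicit Types u v t : R.

(** A sign condition symmetric in the endpoints: their order, which alternates with the parity of
    the depth, never has to be tracked. *)
Lemma open_betweenP u v t : open_between u v t <-> (t - u) * (t - v) < 0.
Proof.
rewrite /open_between /= in_itv /=.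
case: (leP u v) => uv; split.
- by case/andP=> ut tv; rewrite pmulr_rlt0 ?subr_gt0// subr_lt0.
- case: (ltgtP t u) => [tu|ut|->]; last by rewrite subrr mul0r ltxx.
  + by rewrite nmulr_rlt0 ?subr_lt0// subr_gt0 => vt; lra.
  + by rewrite pmulr_rlt0 ?subr_gt0// subr_lt0.
- by case/andP=> ut tv; rewrite nmulr_rlt0 ?subr_lt0// subr_gt0.
- case: (ltgtP t v) => [tv|vt|->]; last by rewrite subrr mulr0 ltxx.
  + by rewrite nmulr_llt0 ?subr_lt0// subr_gt0 => ut; lra.
  + by rewrite pmulr_llt0 ?subr_gt0// subr_lt0.
Qed.

Lemma open_between_divP (a b c d t : R) : 0 < b -> 0 < d ->
  open_between (a / b) (c / d) t <-> (t * b - a) * (t * d - c) < 0.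
Proof.
move=> b0 d0; rewrite open_betweenP.
have -> : (t * b - a) * (t * d - c) = (b * d) * ((t - a / b) * (t - c / d)).
  by field; rewrite !gt_eqF.
by rewrite (pmulr_rlt0 _ (mulr_gt0 b0 d0)).
Qed.

Lemma open_between_convex u v a b t :
  open_between u v a -> open_between u v b -> a <= t <= b -> open_between u v t.
Proof.
rewrite /open_between /= !in_itv /= => /andP[ua _] /andP[_ bv] /andP[at_ tb].
by rewrite (lt_le_trans ua at_) (le_lt_trans tb bv).
Qed.

End OpenBetween.

(** * Convergents, approximation errors and cylinders *)

Section ContinuedFraction.
Variable R : realType.
Implicit Types (x y t : R) (n : nat).

Lemma irrational_neq_div x (p q : nat) : irrational x -> x <> p%:R / q%:R.
Proof.
by move=> irr xE; apply: irr; exists (p%:R / q%:R) => //; rewrite xE fmorph_div /= !ratr_nat.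
Qed.

Lemma gauss_map_irrational x : irrational x -> irrational (gauss_map x).
Proof.
move=> irr [r _ rE]; apply: irr; exists ((r + (Num.truncn x^-1)%:R)^-1) => //.
by rewrite fmorphV rmorphD /= ratr_nat rE /gauss_map subrK invrK.
Qed.

Lemma gauss_map_itv x : irrational x -> 0 < x -> 0 < gauss_map x < 1.
Proof.
move=> irr x0; have /truncn_itv/andP[le_x lt_x] : 0 <= x^-1 by rewrite invr_ge0 ltW.
rewrite /gauss_map subr_gt0 ltrBlDr addrC natr1 lt_x andbT lt_neqAle le_x andbT.
apply/eqP => E; apply: (@irrational_neq_div x 1 (Num.truncn x^-1) irr).
by rewrite E mul1r invrK.
Qed.

Lemma gauss_iter_itv x n : irrational x -> 0 < x < 1 ->
  irrational (iter n (@gauss_map R) x) /\ 0 < iter n (@gauss_map R) x < 1.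
Proof.
move=> irr x01; elim: n => //= n [irrn /andP[n0 _]].
by split; [exact: gauss_map_irrational|exact: gauss_map_itv].
Qed.

Lemma cf_digit_gt0 x n : irrational x -> 0 < x < 1 -> (0 < cf_digit x n)%N.
Proof.
move=> irr x01; have [_ /andP[t0 t1]] := gauss_iter_itv x n.-1 irr x01.
by rewrite /cf_digit truncn_gt0 invf_ge1// ltW.
Qed.

Lemma cf_denS_ge x n : irrational x -> 0 < x < 1 -> (cf_den x n <= cf_den x n.+1)%N.
Proof.
move=> irr x01 /=; apply: leq_trans (leq_addr _ _).
by rewrite leq_pmull// cf_digit_gt0.
Qed.

Lemma cf_den_gt0 x n : irrational x -> 0 < x < 1 -> (0 < cf_den x n)%N.
Proof.
by move=> irr x01; elim: n => // n ih; apply: leq_trans ih (cf_denS_ge _ _ irr x01).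
Qed.

Lemma cf_numSS x n :
  cf_num x n.+2 = (cf_digit x n.+2 * cf_num x n.+1 + cf_num x n)%N.
Proof. by []. Qed.

Lemma cf_denSS x n :
  cf_den x n.+2 = (cf_digit x n.+2 * cf_den x n.+1 + cf_den x n)%N.
Proof. by []. Qed.

Lemma cf_num_le_den x n : irrational x -> 0 < x < 1 -> (cf_num x n <= cf_den x n)%N.
Proof.
move=> irr x01; elim/ltn_ind: n => -[|[|n]] ih //.
  by rewrite /= muln0 add0n muln1 addn0 cf_digit_gt0.
rewrite cf_numSS cf_denSS leq_add ?leq_mul//; apply: ih => //; exact: ltnW.
Qed.

(** The error of the n-th convergent of [x] as an approximation to [t], scaled by its denominator.
    For fixed [t] it obeys the same recurrence as numerators and denominators. *)
Definition cf_err x n t : R := t * (cf_den x n)%:R - (cf_num x n)%:R.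

(* The value of cf_err at index n - 1, where p_{-1} = 1 and q_{-1} = 0. *)
Definition cf_err_prev x n t : R := if n is m.+1 then cf_err x m t else -1.

Lemma cf_errS x n t :
  cf_err x n.+1 t = (cf_digit x n.+1)%:R * cf_err x n t + cf_err_prev x n t.
Proof.
rewrite /cf_err_prev /cf_err; case: n => [|n]; last first.
  rewrite cf_numSS cf_denSS.
  by move: (cf_num x n.+1) (cf_den x n.+1) => p q; rewrite !natrD !natrM; ring.
by rewrite /= muln0 muln1 addn0 add0n; ring.
Qed.

(** Squaring hides the alternating sign of the determinant; the recurrence only flips that sign. *)
Lemma cf_det x n :
  ((cf_num x n.+1)%:Z * (cf_den x n)%:Z - (cf_num x n)%:Z * (cf_den x n.+1)%:Z) ^+ 2 = 1.
Proof.
elim: n => [|n ih]; first by rewrite /= muln0 muln1 addn0 add0n mul0r subr0.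
rewrite -[RHS]ih cf_numSS cf_denSS.
by move: (cf_num x n.+1) (cf_den x n.+1) => p q; rewrite !PoszD !PoszM; ring.
Qed.

(* x = (p_n + s p_{n-1}) / (q_n + s q_{n-1}) where s is the n-th Gauss iterate. *)
Lemma cf_err_gauss x n : irrational x -> 0 < x < 1 ->
  cf_err x n x + iter n (@gauss_map R) x * cf_err_prev x n x = 0 /\ cf_err x n x != 0.
Proof.
move=> irr x01; elim: n => [|n [ih ih0]].
  by rewrite /cf_err /= mulr1 subr0 mulrN1 subrr; split=> //; rewrite gt_eqF//; lra.
have [_ /andP[t0 _]] := gauss_iter_itv x n irr x01.
have [_ /andP[u0 _]] := gauss_iter_itv x n.+1 irr x01.
(* By induction the previous error is minus the current one over [t], so the recurrence multiplies
   the current error by the digit minus [t^-1], which is minus the next iterate. *)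
have E : cf_err x n.+1 x = - iter n.+1 (@gauss_map R) x * cf_err x n x.
  rewrite cf_errS iterS {1}/gauss_map -/(cf_digit x n.+1).
  move: t0 ih; set t := iter n _ _ => t0 /eqP; rewrite addr_eq0 => /eqP ->.
  by rewrite /cf_digit /= -/t; field; rewrite gt_eqF.
rewrite E /=; split; first ring.
by rewrite mulf_neq0// oppr_eq0 gt_eqF.
Qed.

(** The sign form of the interval condition. Unlike [cf_interval] it is correct at depth 0, where it
    reads t (t - 1) < 0, so inductions can start there. *)
Definition cf_cylinder x n t :=
  cf_err x n t * (cf_err x n t + cf_err_prev x n t) < 0.

Lemma cf_interval_divP x n t : irrational x -> 0 < x < 1 ->
  cf_interval x n t <->
  (t * (cf_den x n)%:R - (cf_num x n)%:R)
  * (t * (cf_den x n + cf_den x n.-1)%:R - (cf_num x n + cf_num x n.-1)%:R) < 0.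
Proof.
move=> irr x01; have q0 := cf_den_gt0 x n irr x01.
by apply: open_between_divP; rewrite ltr0n// ltn_addr.
Qed.

Lemma cf_intervalP x n t : irrational x -> 0 < x < 1 -> (0 < n)%N ->
  cf_interval x n t <-> cf_cylinder x n t.
Proof.
move=> irr x01; case: n => // n _.
rewrite cf_interval_divP//.
rewrite /cf_cylinder /cf_err_prev -[n.+1.-1]/n.
suff -> : t * (cf_den x n.+1 + cf_den x n)%:R - (cf_num x n.+1 + cf_num x n)%:R
  = cf_err x n.+1 t + cf_err x n t by [].
by rewrite /cf_err !natrD; ring.
Qed.

(** With s the n-th Gauss iterate and B the previous error, the current error is -sB, so the product
    equals -s(1-s)B^2. *)
Lemma cf_cylinder_self x n : irrational x -> 0 < x < 1 -> cf_cylinder x n x.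
Proof.
move=> irr x01; rewrite /cf_cylinder.
have [_ /andP[t0 t1]] := gauss_iter_itv x n irr x01.
have [/eqP + neq0] := cf_err_gauss x n irr x01.
rewrite addr_eq0 => /eqP E; move: neq0; rewrite E oppr_eq0 mulf_eq0 negb_or => /andP[_ neq0].
set t := iter n (@gauss_map R) x in t0 t1 *; set B := cf_err_prev x n x in neq0 *.
have -> : - (t * B) * (- (t * B) + B) = - (t * (1 - t) * B ^+ 2) by ring.
by rewrite oppr_lt0 pmulr_lgt0 ?exprn_even_gt0// mulr_gt0// subr_gt0.
Qed.

(** The deeper product is (aA + B)((a+1)A + B) with a >= 1. If A and A + B did not have opposite
    signs, adding nonnegative multiples of A to A + B would keep its sign, making this product
    nonnegative. *)
Lemma cf_cylinder_nested x n t : irrational x -> 0 < x < 1 ->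
  cf_cylinder x n.+1 t -> cf_cylinder x n t.
Proof.
move=> irr x01; rewrite /cf_cylinder -[cf_err_prev x n.+1 t]/(cf_err x n t) cf_errS.
have : 1 <= (cf_digit x n.+1)%:R :> R by rewrite ler1n cf_digit_gt0.
set a := _%:R; set A := cf_err x n t; set B := cf_err_prev x n t => a1.
case: (ltgtP A 0) => [A0|A0|->]; last by rewrite mulr0 add0r addr0 -expr2 ltNge sqr_ge0.
- move=> H; rewrite nmulr_rlt0// ltNge; apply/negP => AB.
  move: H; apply/negP; rewrite -leNgt mulr_le0//; nra.
- move=> H; rewrite pmulr_rlt0// ltNge; apply/negP => AB.
  move: H; apply/negP; rewrite -leNgt mulr_ge0//; nra.
Qed.

(** * Digits determined by a cylinder, and denominators inside it *)

Definition same_digits x y n := forall m, (0 < m <= n)%N -> cf_digit x m = cf_digit y m.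

Lemma same_digits_num_den x y n : same_digits x y n ->
  forall m, (m <= n)%N -> cf_num x m = cf_num y m /\ cf_den x m = cf_den y m.
Proof.
move=> xy m; elim/ltn_ind: m => -[|[|m]] ih mn //; first by rewrite /= xy.
rewrite !cf_numSS !cf_denSS.
have [-> ->] := ih m.+1 (ltnSn _) (ltnW mn).
have [-> ->] := ih m (ltnW (ltnSn _)) (ltnW (ltnW mn)).
by rewrite xy.
Qed.

(** Once the first n digits agree, the errors of [y] at [x] are those of [x]. The condition at depth
    n+1 then places the inverse Gauss iterate of [x] between a and a+1, with a the next digit of
    [y], so a is also the next digit of [x]. *)
Lemma cf_cylinder_digits x y n : irrational x -> 0 < x < 1 ->
  irrational y -> 0 < y < 1 -> cf_cylinder y n x -> same_digits x y n.
Proof.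
move=> irrx x01 irry y01; elim: n => [|n ih] cyl; first by move=> [].
have {}ih := ih (cf_cylinder_nested _ _ _ irry y01 cyl).
move=> m /andP[m0]; rewrite leq_eqVlt => /orP[/eqP->|mn]; last by apply: ih; rewrite m0.
have eq_nd := same_digits_num_den _ _ _ ih.
have errE k t : (k <= n)%N -> cf_err y k t = cf_err x k t.
  by move=> kn; rewrite /cf_err; have [-> ->] := eq_nd k kn.
have prevE t : cf_err_prev y n t = cf_err_prev x n t.
  by rewrite /cf_err_prev; case: n errE {eq_nd ih cyl} => // k errE; rewrite errE.
move: cyl; rewrite /cf_cylinder -[cf_err_prev y n.+1 x]/(cf_err y n x) cf_errS prevE errE//.
have [_ /andP[t0 _]] := gauss_iter_itv x n irrx x01.
have [/eqP + neq0] := cf_err_gauss x n irrx x01.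
rewrite addr_eq0 => /eqP E; move: neq0; rewrite E oppr_eq0 mulf_eq0 negb_or => /andP[_ neq0].
rewrite {1}/cf_digit -[n.+1.-1]/n.
set t := iter n (@gauss_map R) x in t0 E *; set B := cf_err_prev x n x in neq0 E *.
set a := cf_digit y n.+1.
have -> : (a%:R * - (t * B) + B) * (a%:R * - (t * B) + B + - (t * B))
  = (t * B) ^+ 2 * ((t^-1 - a%:R) * (t^-1 - a.+1%:R)).
  by rewrite -natr1; field; rewrite gt_eqF.
rewrite pmulr_rlt0 ?exprn_even_gt0//=; last by rewrite mulf_neq0// gt_eqF.
move=> /open_betweenP; rewrite /open_between /= in_itv /= min_l ?max_r ?ler_nat//.
by move=> /andP[? ?]; apply: truncn_def; rewrite ltW.
Qed.

Lemma cf_interval_self x n : irrational x -> 0 < x < 1 -> (0 < n)%N -> cf_interval x n x.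
Proof. by move=> irr x01 n0; rewrite cf_intervalP//; exact: cf_cylinder_self. Qed.

(** A member of the partition is generated by some [y]; if it contains [x], then [x] and [y] share n
    digits and hence both endpoints, so the choice made by [xget] is forced. *)
Lemma cell_CF x n : irrational x -> 0 < x < 1 -> (0 < n)%N ->
  cell CF n x = cf_interval x n.
Proof.
case: n => // n irr x01 _; apply: xget_unique.
  by split; [exists x|exact: cf_interval_self].
move=> _ [[y [irry y01 ->]]]; rewrite cf_intervalP// => /cf_cylinder_digits.
move=> /(_ irr x01 irry y01)/same_digits_num_den eq_nd; rewrite /cf_interval.
have [-> ->] := eq_nd n.+1 (leqnn _).
by have [-> ->] := eq_nd n (leqnSn n).
Qed.

(* With U = cq - pe and V = c(q+q') - (p+p')e, nonzero integers of opposite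
   signs, e = |(q+q') U - q V| = (q+q') |U| + q |V|. *)
Lemma cf_interval_min_den x n (c e : nat) : irrational x -> 0 < x < 1 -> (0 < n)%N ->
  (0 < e)%N -> cf_interval x n (c%:R / e%:R) ->
  (2 * cf_den x n + cf_den x n.-1 <= e)%N.
Proof.
move=> irr x01; case: n => // n _ e0.
rewrite cf_interval_divP// -[n.+1.-1]/n.
have := cf_den_gt0 x n.+1 irr x01.
move: (cf_det x n); move: (cf_num x n.+1) (cf_den x n.+1) (cf_num x n) (cf_den x n).
move=> p q p' q' det q0.
set U : int := c%:Z * q%:Z - p%:Z * e%:Z.
set V : int := c%:Z * (q%:Z + q'%:Z) - (p%:Z + p'%:Z) * e%:Z.
have -> : (c%:R / e%:R * q%:R - p%:R) * (c%:R / e%:R * (q + q')%:R - (p + p')%:R)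
  = (e%:R ^- 2) * (U * V)%:~R :> R.
  rewrite !natrD /U /V !(intrD, intrM, intrN, mulrNz) -!pmulrn. field.
  by rewrite pnatr_eq0 -lt0n.
rewrite pmulr_rlt0 ?invr_gt0 ?exprn_gt0 ?ltr0n// ltrz0 => UV.
have [d d1 eE] : exists2 d : int, d = 1 \/ d = -1 & e%:Z = d * ((q%:Z + q'%:Z) * U - q%:Z * V).
  (* The terms in c cancel in (q+q')U - qV, leaving minus the determinant times e; the squared
     determinant is 1. *)
  exists (- (p%:Z * q'%:Z - p'%:Z * q%:Z)); last first.
    rewrite /U /V; transitivity ((p%:Z * q'%:Z - p'%:Z * q%:Z) ^+ 2 * e%:Z); last ring.
    by rewrite det mul1r.
  move/eqP: det; rewrite sqrf_eq1 => /orP[]/eqP ->; [right|left]; ring.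
move: U V UV eE => U V UV eE {det}.
have [[U0 V0]|[U0 V0]] : (0 < U /\ V < 0) \/ (U < 0 /\ 0 < V).
  case: (ltgtP U 0) UV => [U0|U0|->]; last by rewrite mul0r.
  - by rewrite nmulr_rlt0//; right.
  - by rewrite pmulr_rlt0//; left.
(* The wrong sign of [d] would make e negative; for the right one, |U| >= 1 and |V| >= 1 give the
   bound. *)
all: case: d1 eE => ->; nia.
Qed.

End ContinuedFraction.

(** * Farey points and Farey cells *)

Section FareyPartition.
Variable R : realType.
Implicit Types (x : R) (l : nat).

(** Dividing by the gcd only lowers the denominator, so later witnesses need no coprimality
    proof. *)
Lemma farey_points_div l (c e : nat) : (c <= e <= l.+1)%N -> (0 < e)%N ->
  farey_points l (c%:R / e%:R : R).
Proof.
move=> /andP[ce el] e0; have g0 : (0 < gcdn c e)%N by rewrite gcdn_gt0 e0 orbT.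
exists (c %/ gcdn c e)%N, (e %/ gcdn c e)%N; split.
- by rewrite leq_div2r//= (leq_trans (leq_div _ _)).
- by rewrite divn_gt0// dvdn_leq// dvdn_gcdr.
- rewrite /coprime -(eqn_pmul2r g0) mul1n muln_gcdl !divnK ?dvdn_gcdl ?dvdn_gcdr//.
- have gn0 : (gcdn c e)%:R != 0 :> R by rewrite pnatr_eq0 -lt0n.
  move: (divnK (dvdn_gcdl c e)) (divnK (dvdn_gcdr c e)) => /(congr1 (@GRing.natmul R 1)) <-.
  by move=> /(congr1 (@GRing.natmul R 1)) <-; rewrite !natrM -mulf_div divff// mulr1.
Qed.

(** A finite superset is enough for a largest Farey point below [x] to exist. *)
Lemma farey_points_seq l : exists s : seq R, forall r, farey_points l r -> r \in s.
Proof.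
exists [seq p%:R / q%:R | p <- iota 0 l.+2, q <- iota 0 l.+2] => _ [p [q [/andP[pq ql] _ _ ->]]].
by apply/allpairsP; exists (p, q); rewrite !mem_iota /=; split=> //; lia.
Qed.

Lemma farey_max_below l x : 0 < x -> exists a : R,
  [/\ farey_points l a, a < x & forall c, farey_points l c -> c < x -> c <= a].
Proof.
move=> x0; have [s sP] := farey_points_seq l.
suff [a [al ax amax]] : exists a : R,
    [/\ farey_points l a, a < x & forall c, c \in s -> farey_points l c -> c < x -> c <= a].
  by exists a; split=> // c lc; apply: amax => //; apply: sP.
elim: s {sP} => [|b s [a [al ax amax]]].
  by exists (0%:R / 1%:R); split=> //; [exact: farey_points_div|rewrite mul0r].
have [[lb bx ab]|nb] := pselect [/\ farey_points l b, b < x & a < b].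
  exists b; split=> // c; rewrite inE => /orP[/eqP->//|cs lc cx].
  exact: le_trans (amax _ cs lc cx) (ltW ab).
exists a; split=> // c; rewrite inE => /orP[/eqP->|cs lc cx]; last exact: amax.
by move=> lb bx; rewrite leNgt; apply/negP => ab; apply: nb.
Qed.

Lemma farey_min_above l x : x < 1 -> exists b : R,
  [/\ farey_points l b, x < b & forall c, farey_points l c -> x < c -> b <= c].
Proof.
(* The reflection r -> 1 - r preserves Farey points and turns this into the previous lemma. *)
have flip (r : R) : farey_points l r -> farey_points l (1 - r).
  move=> [p [q [/andP[pq ql] q0 _ ->]]].
  rewrite (_ : 1 - _ = (q - p)%:R / q%:R); last first.
    by rewrite natrB// mulrBl divff// pnatr_eq0 -lt0n.
  by apply: farey_points_div => //; rewrite leq_subr.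
move=> x1; have /(farey_max_below l)[a [la ax amax]] : 0 < 1 - x by lra.
exists (1 - a); split; [exact: flip|lra|].
by move=> c /flip lc xc; have := amax _ lc; lra.
Qed.

Lemma farey_cell_exists l x : irrational x -> 0 < x < 1 -> exists I, Farey l I /\ I x.
Proof.
move=> irr /andP[x0 x1].
have [a [la ax amax]] := farey_max_below l x x0.
have [b [lb xb bmin]] := farey_min_above l x x1.
exists [set` `]a, b[]; split; last by rewrite /= in_itv /= ax.
exists a, b; split=> //; first exact: lt_trans xb.
move=> c lc; apply/negP => /andP[ac cb].
case: (ltgtP c x) => [cx|xc|cx].
- by have := amax _ lc cx; rewrite leNgt ac.
- by have := bmin _ lc xc; rewrite leNgt cb.
- by case: lc cx => p [q [_ _ _ ->]] /esym; exact: irrational_neq_div.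
Qed.

(** The endpoints of the cell are Farey points and none lies inside it. If a point of [I] were
    outside, convexity would put an endpoint between it and [x], hence in [I]. *)
Lemma convex_sub_farey_cell l x (I : set R) : irrational x -> 0 < x < 1 -> I x ->
  (forall a b t, I a -> I b -> a <= t <= b -> I t) ->
  (I `<=` cell Farey l x) <-> (forall r, farey_points l r -> ~ I r).
Proof.
move=> irr x01 Ix Iconv.
have [+ xJ] : Farey l (cell Farey l x) /\ cell Farey l x x.
  exact: xgetPex (farey_cell_exists l x irr x01).
move: (cell Farey l x) xJ => J + [a [b [la lb ab gap JE]]].
rewrite {J}JE /= in_itv /= => /andP[ax xb]; split=> [sub r lr /sub|avoid z Iz].
  by rewrite /= in_itv /=; apply/negP; exact: gap.
rewrite /= in_itv /=; apply/andP; split; rewrite ltNge; apply/negP => zle.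
- by apply: (avoid a la); apply: (Iconv z x) => //; rewrite zle ltW.
- by apply: (avoid b lb); apply: (Iconv x z) => //; rewrite zle ltW.
Qed.

End FareyPartition.

(** * The mediant and the value of the Lochs index *)

Lemma cf_mediant_interval (R : realType) (x : R) n : irrational x -> 0 < x < 1 -> (0 < n)%N ->
  cf_interval x n
    ((2 * cf_num x n + cf_num x n.-1)%:R / (2 * cf_den x n + cf_den x n.-1)%:R).
Proof.
move=> irr x01; case: n => // n _.
rewrite cf_interval_divP// -[n.+1.-1]/n.
have := cf_den_gt0 _ x n.+1 irr x01.
move: (cf_det _ x n); move: (cf_num x n.+1) (cf_den x n.+1) (cf_num x n) (cf_den x n).
move=> p q p' q' /(congr1 (fun z : int => z%:~R : R)).
rewrite rmorphXn rmorphB !rmorphM /= -!pmulrn mulr1n => det q0.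
have m0 : 0 < (2 * q + q')%:R :> R by rewrite ltr0n; lia.
(* At the mediant the two factors are plus and minus the determinant over 2q + q', so the product is
   minus a square. *)
rewrite [X in X < 0](_ : _ =
    - ((p%:R * q'%:R - p'%:R * q%:R) ^+ 2 / (2 * q + q')%:R ^+ 2)).
  by rewrite det mul1r oppr_lt0 invr_gt0 exprn_gt0.
by move: m0; rewrite !(natrM, natrD) => m0; field; rewrite gt_eqF.
Qed.

Theorem proposition5p3 (R : realType) (x : R) (n : nat) :
  irrational x -> 0 < x < 1 -> (1 <= n)%N ->
  lochs_index n x CF Farey
  = (2 * (cf_den x n)%:R + (cf_den x n.-1)%:R - 2)%:E.
Proof.
move=> irr x01 n0; rewrite /lochs_index cell_CF//.
have q0 := cf_den_gt0 _ x n irr x01.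
pose N := (2 * cf_den x n + cf_den x n.-1)%N.
(* Makes the truncated subtraction [N - 2] exact. *)
have N2 : (2 <= N)%N by rewrite /N; lia.
have -> : 2 * (cf_den x n)%:R + (cf_den x n.-1)%:R - 2 = (N - 2)%:R :> R.
  by rewrite natrB// natrD natrM.
(* Depth [l] allows denominators up to l + 1, so Farey points avoid the interval exactly when l + 1
   < N. *)
have subP l : cf_interval x n `<=` cell Farey l x <-> (l <= N - 2)%N.
  rewrite convex_sub_farey_cell//.
  - split=> [avoid|lN _ [p [q [/andP[_ ql] q1 _ ->]]] /cf_interval_min_den].
      rewrite leqNgt; apply/negP => Nl; apply: avoid (cf_mediant_interval _ _ _ irr x01 n0).
      apply: farey_points_div; rewrite -/N; last lia.
      (* The mediant is at most 1 because each numerator is at most its denominator. *)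
      rewrite {1}/N leq_add ?leq_mul ?cf_num_le_den//=; lia.
    by move=> /(_ irr x01 n0 q1); rewrite -/N; lia.
  - exact: cf_interval_self.
  - by move=> a b t; exact: open_between_convex.
apply/eqP; rewrite eq_le; apply/andP; split.
  by apply: ge_ereal_sup => _ [l /= /subP lN <-]; rewrite lee_fin ler_nat.
by apply: ereal_sup_ubound; exists (N - 2)%N => //=; apply/subP.
Qed.
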